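(* Let $d\geq 1$ and let $\lambda=(\lambda_1,\dots,\lambda_d)$ be a partition of length at most $d$ (i.e. integers $\lambda_1\geq\lambda_2\geq\dots\geq\lambda_d\geq 0$). Then the factorial Grothendieck polynomial $G_\lambda(x|b)$ satisfies \[ G_{\lambda}(x|b) = \det\left(\sum_{s\geq 0} \binom{i-d}{s} \beta^s\,G_{\lambda_i+j-i+s}^{(\lambda_i+d-i)}(x|b)\right)_{1\leq i,j\leq d} = \det\left(\sum_{s\geq 0} \binom{i-j}{s} \beta^s\,G_{\lambda_i+j-i+s}^{(\lambda_i+d-i)}(x|b)\right)_{1\leq i,j\leq d}. \] In particular, for every integer $k\geq 0$, $G_{(k,0,\dots,0)}(x|b) = G_k^{(k+d-1)}(x|b)$.
   Context: Let $x=(x_1,\dots,x_d)$ and $b=(b_1,b_2,\dots)$ be sets of indeterminates and $\beta$ a further formal variable (of degree $-1$); all expressions live in the ring $\mathbb{Z}[\beta,b_1,b_2,\dots][[x_1,\dots,x_d]]$. For variables $x,y$ set $x\oplus y:=x+y+\beta xy$ and $[y|b]^k:=(y\oplus b_1)(y\oplus b_2)\cdots(y\oplus b_k)$ for $k\geq 0$. For a partition $\lambda$ of length at most $d$, the factorial Grothendieck polynomial is \[ G_{\lambda}(x|b) =\frac{\det\left([x_j|b]^{\lambda_i+d-i}(1+\beta x_j)^{i-1}\right)_{1\leq i,j\leq d}}{\prod_{1\leq i<j\leq d}(x_i-x_j)} \] (this bi-alternant expression agrees with McNamara's definition via set-valued tableaux). For each integer $k\geq 0$ define $G_m^{(k)}(x|b)$,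 $m\in\mathbb{Z}$, by the generating function \[ \sum_{m\in\mathbb{Z}} G_m^{(k)}(x|b)\,u^m := \frac{1}{1+\beta u^{-1}}\prod_{i=1}^d\frac{1+\beta x_i}{1- x_i u} \prod_{j=1}^{k} \bigl(1+ (u+\beta)b_j\bigr), \] where $\frac{1}{1+\beta u^{-1}}$ is expanded as $\sum_{s\geq 0}(-1)^s\beta^s u^{-s}$ and $\frac{1}{1-x_iu}=\sum_{n\ge0}x_i^nu^n$. The binomial coefficients are generalized: for $n\in\mathbb{Z}$, $\binom{n}{i}$ is defined by $(1+x)^n=\sum_{i\geq0}\binom{n}{i}x^i$, with $\binom{n}{-i}=0$ for integers $i>0$. *)

(* Defs.v *)
From HB Require Import structures.
From mathcomp Require Import all_boot all_order all_algebra.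
From mathcomp Require Import mpoly.
Set Implicit Arguments. Unset Strict Implicit. Unset Printing Implicit Defensive.
Import Order.TTheory GRing.Theory Num.Theory.
Local Open Scope ring_scope.

(* Generalized binomial coefficient binom(n, s) for n : int, s : nat,
   defined as the coefficient of x^s in (1+x)^n, where for n < 0,
   (1+x)^n = ((1+x)^{-1})^{|n|} with (1+x)^{-1} = sum_i (-1)^i x^i
   (truncated at degree s, which does not affect the coefficient of x^s). *)
Definition gbinom (n : int) (s : nat) : int :=
  match n with
  | Posz k => ((('X + 1 : {poly int}) ^+ k)`_s)
  | Negz k => (((\sum_(i < s.+1) ((-1) ^+ i) *: 'X^i : {poly int}) ^+ k.+1)`_s)
  end.

Section Groth.
Variables (R : comNzRingType) (d : nat) (beta : R) (b : nat -> R).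

Definition oplus (p q : {mpoly R[d]}) : {mpoly R[d]} := p + q + beta%:MP * p * q.

Definition fpow (y : {mpoly R[d]}) (k : nat) : {mpoly R[d]} :=
  \prod_(1 <= l < k.+1) oplus y (b l)%:MP.

(* Numerator of the bi-alternant formula (0-based indices i, j : 'I_d;
   the paper's row i is our row i.+1, so lambda_i + d - i becomes
   lam i + (d - i.+1) and (1 + beta x_j)^(i-1) becomes ^+ i). *)
Definition bialt (lam : 'I_d -> nat) : {mpoly R[d]} :=
  \det (\matrix_(i < d, j < d)
          (fpow 'X_j (lam i + (d - i.+1)) * (1 + beta%:MP * 'X_j) ^+ i)).

Definition vdm : {mpoly R[d]} :=
  \prod_(i : 'I_d) \prod_(j : 'I_d | (i < j)%N) ('X_i - 'X_j).

(* Formal power series in x_1..x_d over R, given by their coefficient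
   functions on monomials. *)
Definition ps := 'X_{1..d} -> R.

Definition trunc (N : nat) (f : ps) : {mpoly R[d]} :=
  \sum_(m : 'X_{1..d < N}) f m *: 'X_[m].

Definition ps_of_poly (p : {mpoly R[d]}) : ps := fun m => p@_m.

(* Determinant in R[[x]]: the coefficient of x^m of det(M) only depends on
   the truncations of the entries to total degree <= deg m. *)
Definition ps_det (M : 'I_d -> 'I_d -> ps) : ps := fun m =>
  (\det (\matrix_(i < d, j < d) trunc (mdeg m).+1 (M i j)))@_m.

(* B_N(u) := prod_i (1 + beta x_i) * prod_i (sum_{e<=N} x_i^e u^e)
             * prod_{l=1}^k (1 + (u + beta) b_l),
   a polynomial in u over R[x]; its coefficient of x^g u^n agrees with that
   of prod_i (1+beta x_i)/(1 - x_i u) * prod_{l=1}^k (1+(u+beta)b_l)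
   whenever deg g <= N. *)
Definition Bpoly (N k : nat) : {poly {mpoly R[d]}} :=
  (\prod_(i : 'I_d) (1 + beta *: 'X_i))%:P
  * (\prod_(i : 'I_d) \sum_(e < N.+1) ('X_i ^+ e)%:P * 'X^e)
  * \prod_(1 <= l < k.+1) (1 + ('X + (beta%:MP)%:P) * ((b l)%:MP)%:P).

Definition Bcoef (k : nat) (n : int) (g : 'X_{1..d}) : R :=
  if (0 <= n)%R then ((Bpoly (mdeg g) k)`_(absz n))@_g else 0.

(* G_m^{(k)}(x|b): coefficient of u^m in
   (sum_{s>=0} (-beta)^s u^{-s}) * prod_i (1+beta x_i)/(1-x_i u)
   * prod_{l=1}^k (1+(u+beta) b_l).
   The coefficient of x^g is sum_{s>=0} (-beta)^s [x^g u^{m+s}](...), and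
   the terms with m + s > deg g + k vanish, so s ranges over a finite set. *)
Definition Gk (k : nat) (m : int) : ps := fun g =>
  \sum_(s < mdeg g + k + `|m|%N + 1) (- beta) ^+ s * Bcoef k (m + s%:Z) g.

(* sum_{s>=0} binom(a, s) beta^s G_{m+s}^{(k)}  (coefficientwise finite:
   the coefficient of x^g of G_{m+s}^{(k)} vanishes when m+s > deg g + k) *)
Definition ent (a : int) (k : nat) (m : int) : ps := fun g =>
  \sum_(s < mdeg g + k + `|m|%N + 1)
     (gbinom a s)%:~R * beta ^+ s * Gk k (m + s%:Z) g.

(* The two matrices of the theorem, with 0-based indices
   (paper: i = i0+1, j = j0+1). *)
Definition M1 (lam : 'I_d -> nat) (i j : 'I_d) : ps :=
  ent ((i.+1)%:Z - d%:Z) (lam i + (d - i.+1)) ((lam i)%:Z + j%:Z - i%:Z).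

Definition M2 (lam : 'I_d -> nat) (i j : 'I_d) : ps :=
  ent (i%:Z - j%:Z) (lam i + (d - i.+1)) ((lam i)%:Z + j%:Z - i%:Z).

Definition row_part (k : nat) : 'I_d -> nat := fun i => if val i == 0%N then k else 0%N.

End Groth.

(* Main.v *)
(** Write [u^m] for coefficient extraction. With
      P(u) = prod_p (1 + beta x_p) / (1 - x_p u)  and
      B_k(u) = prod_(l <= k) (1 + (u + beta) b_l),
    the (i, j) entries (1-based) of the two determinants are
      [u^k] (1 + beta/u)^(i-d-1) P B_k u^(d-j)  and
      [u^k] (1 + beta/u)^(i-d-1) P B_k (u + beta)^(d-j),   k = lambda_i + d - i.
    So row i is one linear functional evaluated on two monic bases of the
    polynomials of degree < d in u, and the two determinants agree. On the third
    family Q_p = prod_(q <> p) (1 - x_q u), the functional leaves the single pole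
    1 / (1 - x_p u) and evaluates to
      prod_q (1 + beta x_q) * (1 + beta x_p)^(i-d-1) * [x_p|b]^k,
    whose determinant is the bi-alternant numerator. The change of basis from u^(d-j)
    to Q_p has the Vandermonde product as determinant, because evaluating the reversed
    Q_p at the x_q gives a diagonal matrix. Power series in x are handled in the
    quotient of the polynomial ring by the monomials of degree > N, where each x_p
    is nilpotent; the differences x_i - x_j are cancelled at the end, each at the
    cost of one degree. *)
Require Import Defs.
From HB Require Import structures.
From mathcomp Require Import all_boot all_order all_algebra.
From mathcomp Require Import mpoly zify ring.
Set Implicit Arguments. Unset Strict Implicit. Unset Printing Implicit Defensive.
Import GRing.Theory.
Local Open Scope ring_scope.


(** * Truncated geometric series and generalized binomial coefficients *)

Lemma coef_exp_congr {A : nzRingType} {N : nat} {p q : {poly A}} (k : nat) :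
  (forall i, (i <= N)%N -> p`_i = q`_i) ->
  forall i, (i <= N)%N -> (p ^+ k)`_i = (q ^+ k)`_i.
Proof.
move=> pq; elim: k => [|k IHk] i iN; first by rewrite !expr0.
rewrite !exprS !coefM; apply: eq_bigr => l _.
by have li := ltn_ord l; rewrite pq ?IHk //; lia.
Qed.

Definition geometric {A : nzRingType} (c : A) (N : nat) : {poly A} :=
  \sum_(e < N.+1) (c ^+ e)%:P * 'X^e.

Lemma coef_geometric {A : nzRingType} (c : A) N i :
  (geometric c N)`_i = if (i <= N)%N then c ^+ i else 0.
Proof.
suff -> : geometric c N = \poly_(e < N.+1) c ^+ e by rewrite coef_poly ltnS.
by rewrite poly_def; apply: eq_bigr => e _; rewrite mul_polyC.
Qed.

Lemma geometricM {A : comNzRingType} (c : A) N :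
  (1 - c%:P * 'X) * geometric c N = 1 - (c ^+ N.+1)%:P * 'X^(N.+1).
Proof.
rewrite /geometric; elim: N => [|N IHN].
  by rewrite big_ord1 !expr0 !expr1 polyC1 !mulr1.
rewrite big_ord_recr /= mulrDr IHN !(exprS _ N.+1) polyCM.
ring.
Qed.

(** [gbinom] truncates the series of 1/(1+x) at the very degree it reads off. Any larger truncation
    gives the same value, so coefficients of different degrees can be read off one polynomial. *)
Lemma gbinom_Negz k s N : (s <= N)%N ->
  gbinom (Negz k) s = (geometric (-1) N ^+ k.+1)`_s.
Proof.
move=> sN /=; have -> : \sum_(i < s.+1) (-1) ^+ i *: 'X^i = geometric (-1 : int) s.
  by apply: eq_bigr => i _; rewrite mul_polyC.
apply: (@coef_exp_congr _ s) => // i is_; rewrite !coef_geometric is_.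
by rewrite (leq_trans is_ sN).
Qed.

Lemma gbinom0 a : gbinom a 0 = 1.
Proof.
case: a => k; last first.
  rewrite (gbinom_Negz k (leqnn 0)).
  by rewrite /geometric big_ord1 expr0 mulr1 expr1n coef1.
rewrite /gbinom (_ : ('X + 1 : {poly int}) ^+ k = (1 + 'X) ^+ k); last by rewrite addrC.
elim: k => [|k IHk]; first by rewrite expr0 coef1.
by rewrite exprS mulrDl mul1r coefD coefXM IHk addr0.
Qed.

Lemma gbinom_nat0 s : gbinom 0 s = (s == 0)%:R.
Proof. exact: coef1. Qed.

Lemma gbinomS a n : gbinom (a + 1) n.+1 = gbinom a n.+1 + gbinom a n.
Proof.
case: a => k.
  rewrite (_ : Posz k + 1 = Posz k.+1); last by lia.
  by rewrite /gbinom exprS mulrDl mul1r coefD coefXM /= addrC.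
set g := geometric (-1 : int) n.+1.
have gX : ('X + 1) * g = 1 - ((-1) ^+ n.+2)%:P * 'X^(n.+2).
  by rewrite -geometricM; congr (_ * _); rewrite polyCN polyC1 mulN1r opprK addrC.
(* [g] inverts 1 + x up to an error of degree n + 2, which cannot reach the coefficient of degree n
   + 1. *)
have key p : (('X + 1) * (g * p))`_n.+1 = p`_n.+1.
  rewrite mulrA gX mulrBl mul1r coefB -mulrA coefCM mulrC coefXnM.
  by rewrite ltnSn mul0r subr0.
have -> : gbinom (Negz k + 1) n.+1 = (g ^+ k)`_n.+1.
  case: k => [|k]; first by rewrite (_ : Negz 0 + 1 = 0) // gbinom_nat0 expr0 coef1.
  rewrite (_ : Negz k.+1 + 1 = Negz k); last by lia.
  exact: gbinom_Negz.
rewrite (gbinom_Negz k (leqnn n.+1)) (gbinom_Negz k (leqnSn n)) -/g.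
by rewrite -key exprS mulrDl mul1r coefD coefXM /= addrC.
Qed.

Local Arguments gbinom : simpl never.

(** * Coefficient extraction from (1 + beta/u)^a F(u) *)

Section Laurent.
Variables (A : comNzRingType) (beta : A).
Implicit Types (a m z : int) (F G : {poly A}).

(* [u^(-z)] (1 + beta/u)^a *)
Definition binw a z : A :=
  if z is Posz s then (gbinom a s)%:~R * beta ^+ s else 0.

Lemma binw_lt0 a z : z < 0 -> binw a z = 0.
Proof. by case: z. Qed.

Lemma binw0 z : binw 0 z = (z == 0)%:R.
Proof.
case: z => [[|s]|s] //=; rewrite gbinom_nat0 ?mulr1 //.
by rewrite mul0r.
Qed.

(** Coefficient form of multiplying (1 + beta/u)^a by one more factor 1 + beta/u. *)
Lemma binw_pascal a z : binw (a + 1) z = binw a z + beta * binw a (z - 1).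
Proof.
case: z => [[|s]|s]; last 1 first.
- by rewrite !binw_lt0 ?mulr0 ?addr0 //; lia.
- by rewrite (@binw_lt0 a (0 - 1)) // mulr0 addr0 /= !gbinom0.
rewrite (_ : Posz s.+1 - 1 = Posz s); last by lia.
by rewrite /binw gbinomS exprS intrD; ring.
Qed.

(* [u^m] (1 + beta/u)^a F(u) *)
Definition lcoef a m F : A := \sum_(n < size F) F`_n * binw a (n%:Z - m).

Lemma lcoef_widen a m F H : (size F <= H)%N ->
  lcoef a m F = \sum_(n < H) F`_n * binw a (n%:Z - m).
Proof.
move=> sF; rewrite /lcoef (big_ord_widen _ (fun n => F`_n * binw a (n%:Z - m)) sF).
rewrite big_mkcond; apply: eq_bigr => i _; case: ltnP => // si.
by rewrite nth_default ?mul0r.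
Qed.

Fact lcoef_is_linear a m : linear (lcoef a m : {poly A} -> A^o).
Proof.
move=> c F G; set H := maxn (size (c *: F + G)) (maxn (size F) (size G)).
rewrite !(@lcoef_widen a m _ H) ?/H; try lia.
rewrite scaler_sumr -big_split; apply: eq_bigr => n _ /=.
by rewrite coefD coefZ mulrDl -mulrA.
Qed.

HB.instance Definition _ a m :=
  GRing.isLinear.Build A {poly A} A^o _ (lcoef a m) (lcoef_is_linear a m).

Lemma lcoefD a m F G : lcoef a m (F + G) = lcoef a m F + lcoef a m G.
Proof. exact: linearD. Qed.

Lemma lcoef_sum a m (I : finType) (F : I -> {poly A}) :
  lcoef a m (\sum_i F i) = \sum_i lcoef a m (F i).
Proof. exact: linear_sum. Qed.

Lemma lcoefCM a m c F : lcoef a m (c%:P * F) = c * lcoef a m F.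
Proof. by rewrite mul_polyC linearZ. Qed.

Lemma lcoefMX a m F : lcoef a m (F * 'X) = lcoef a (m - 1) F.
Proof.
rewrite (@lcoef_widen a m _ (size F).+1); last first.
  by rewrite (leq_trans (size_polyMleq _ _)) // size_polyX addn2.
rewrite big_ord_recl coefMX mul0r add0r; apply: eq_bigr => n _.
by rewrite coefMX /=; congr (_ * binw a _); rewrite /bump /=; lia.
Qed.

Lemma lcoefMXn a m n F : lcoef a m (F * 'X^n) = lcoef a (m - n%:Z) F.
Proof.
elim: n m => [|n IHn] m; first by rewrite mulr1 subr0.
by rewrite exprSr mulrA lcoefMX IHn; congr (lcoef a _ F); lia.
Qed.

Lemma lcoef_pascal a m F : lcoef (a + 1) m F = lcoef a m F + beta * lcoef a (m + 1) F.
Proof.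
rewrite /lcoef mulr_sumr -big_split; apply: eq_bigr => n _ /=.
rewrite binw_pascal (_ : n%:Z - m - 1 = n%:Z - (m + 1)); last by lia.
ring.
Qed.

(** Since u + beta = u (1 + beta/u), the factor is absorbed by raising the exponent and lowering the
    extracted degree. *)
Lemma lcoefMXD a m F : lcoef a m (F * ('X + beta%:P)) = lcoef (a + 1) (m - 1) F.
Proof.
rewrite mulrDr lcoefD lcoefMX [F * _]mulrC lcoefCM lcoef_pascal.
by rewrite subrK.
Qed.

Lemma lcoefMXDn a m n F :
  lcoef a m (F * ('X + beta%:P) ^+ n) = lcoef (a + n%:Z) (m - n%:Z) F.
Proof.
elim: n a m => [|n IHn] a m; first by rewrite mulr1 subr0 addr0.
rewrite exprSr mulrA lcoefMXD IHn; congr (lcoef _ _ F); lia.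
Qed.

Lemma lcoef0 m F : lcoef 0 m F = if m is Posz n then F`_n else 0.
Proof.
case: m => m; last first.
  rewrite /lcoef big1 // => n _.
  have /negbTE nm : n%:Z - Negz m != 0 by lia.
  by rewrite binw0 nm mulr0.
rewrite (@lcoef_widen _ _ _ (maxn (size F) m.+1)) ?leq_maxl //.
have mH : (m < maxn (size F) m.+1)%N by lia.
rewrite (bigD1 (Ordinal mH)) //= binw0 subrr mulr1 big1 ?addr0 // => n nm.
rewrite binw0 subr_eq0.
have /negbTE -> : n%:Z != m%:Z.
  by rewrite eqz_nat; apply: contra nm => /eqP e; exact/eqP/val_inj.
by rewrite mulr0.
Qed.

Lemma binwN1 s : binw (-1) (Posz s) = (- beta) ^+ s.
Proof.
suff -> : binw (-1) (Posz s) = (-1) ^+ s * beta ^+ s by rewrite -exprMn mulN1r.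
rewrite /binw (gbinom_Negz 0 (leqnn s)) expr1 coef_geometric leqnn.
by rewrite rmorphXn /= rmorphN1.
Qed.

(** 1/(1 + beta/u) is the sum of the (-beta)^s u^(-s), so its constant-term pairing with u^s
    substitutes -beta for u. *)
Lemma lcoefN1_horner F : lcoef (-1) 0 F = F.[- beta].
Proof.
by rewrite horner_coef; apply: eq_bigr => n _; rewrite subr0 binwN1.
Qed.

(** Expresses (1 + beta/u)^a (1 + beta/u)^(-1) = (1 + beta/u)^(a-1). It merges the binomial sum of a
    matrix entry with the factor 1/(1 + beta/u) inside each G. *)
Lemma binw_conv a (z : int) K : z < K%:Z ->
  \sum_(s < K) (gbinom a s)%:~R * beta ^+ s * binw (-1) (z - s%:Z) = binw (a - 1) z.
Proof.
case: z => [n|n] zK; last first.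
  by rewrite big1 => [|s _]; rewrite binw_lt0 ?mulr0 //; lia.
have {zK} nK : (n < K)%N by lia.
rewrite -(subnKC nK) big_split_ord /= [X in _ + X]big1 ?addr0; last first.
  by move=> s _; rewrite binw_lt0 ?mulr0 //; lia.
elim: n {K nK} => [|n IHn].
  by rewrite big_ord1 /= !gbinom0 !mul1r.
have pascal : binw (a - 1) n.+1%:Z = binw a n.+1%:Z - beta * binw (a - 1) n%:Z.
  have := binw_pascal (a - 1) n.+1%:Z.
  by rewrite subrK (_ : n.+1%:Z - 1 = n%:Z) => [->|]; [rewrite addrK | lia].
have b0 : binw (-1) 0 = 1 by rewrite /= gbinom0 mul1r.
rewrite -/(binw (a - 1) n.+1%:Z) pascal big_ord_recr /= subrr b0 mulr1.
rewrite -IHn mulr_sumr addrC; congr (_ + _).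
rewrite -sumrN; apply: eq_bigr => s _.
have -> : n.+1%:Z - s%:Z = Posz (n - s).+1 by case: s => s /= ?; lia.
have -> : n%:Z - s%:Z = Posz (n - s) by case: s => s /= ?; lia.
by rewrite -!/(binw _ (Posz _)) !binwN1 exprS; ring.
Qed.
End Laurent.

(** * The functional on a single pole 1/(1 - c u) with c nilpotent *)

Section NilpotentVariable.
Variables (A : comNzRingType) (beta c : A) (N : nat).
Hypothesis c_nil : c ^+ N.+1 = 0.
Let g := geometric c N.

Lemma geometric_inv : (1 - c%:P * 'X) * g = 1.
Proof. by rewrite geometricM c_nil mul0r subr0. Qed.

Lemma lcoef_high a (m : nat) (F : {poly A}) :
  (size F <= m)%N -> lcoef beta a m F = 0.
Proof.
move=> sF; rewrite /lcoef big1 // => n _; have nF := ltn_ord n.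
by rewrite binw_lt0 ?mulr0 //; lia.
Qed.

(** From g = c u g + 1 comes g F = c u g F + F, and F has too small a degree to contribute in degree
    m + 1. *)
Lemma lcoef_geometric_step a (m : nat) (F : {poly A}) : (size F <= m.+1)%N ->
  lcoef beta a m.+1 (g * F) = c * lcoef beta a m (g * F).
Proof.
move=> sF; have gF : g * F = c%:P * (g * F * 'X) + F.
  by rewrite -[X in _ = _ + X]mul1r -geometric_inv; ring.
rewrite [in LHS]gF lcoefD (lcoef_high _ sF) addr0 lcoefCM lcoefMX.
by rewrite (_ : m.+1%:Z - 1 = m); last by lia.
Qed.

Lemma lcoef_geometricS (a : int) :
  lcoef beta (a + 1) 0 g = (1 + beta * c) * lcoef beta a 0 g.
Proof.
have := @lcoef_geometric_step a 0 1; rewrite size_poly1 mulr1 => step.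
by rewrite lcoef_pascal add0r step //; ring.
Qed.

Lemma lcoef_geometricD (a : int) n :
  lcoef beta (a + n%:Z) 0 g = (1 + beta * c) ^+ n * lcoef beta a 0 g.
Proof.
elim: n => [|n IHn]; first by rewrite addr0 mul1r.
rewrite exprS -mulrA -IHn -lcoef_geometricS; congr (lcoef _ _ _ _); lia.
Qed.

(** Provides (1 + beta c)^(-n) as a value of the functional, so that no division is required. *)
Lemma lcoef_geometricN n : (1 + beta * c) ^+ n * lcoef beta (- n%:Z) 0 g = 1.
Proof. by rewrite -lcoef_geometricD addNr lcoef0 /= coef_geometric. Qed.

Variable b : nat -> A.

Definition shifted_factors k : {poly A} :=
  \prod_(1 <= l < k.+1) (1 + ('X + beta%:P) * (b l)%:P).

Lemma shifted_factorsS k : shifted_factors k.+1 =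
  shifted_factors k * ((1 + beta * b k.+1)%:P + (b k.+1)%:P * 'X).
Proof.
rewrite /shifted_factors big_nat_recr //=; congr (_ * _).
by rewrite polyCD polyCM polyC1; ring.
Qed.

Lemma size_shifted_factors k : (size (shifted_factors k) <= k.+1)%N.
Proof.
elim: k => [|k IHk]; first by rewrite /shifted_factors big_geq // size_poly1.
rewrite shifted_factorsS (leq_trans (size_polyMleq _ _)) //.
suff : (size ((1 + beta * b k.+1)%:P + (b k.+1)%:P * 'X)%R <= 2)%N by lia.
rewrite (leq_trans (size_polyD _ _)) // geq_max (leq_trans (size_polyC_leq1 _)) //=.
by rewrite mul_polyC (leq_trans (size_scale_leq _ _)) // size_polyX.
Qed.

(** Each factor is (1 + beta b_l) + b_l u. When the degree rises by one, its constant part gains a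
    factor c and its u part does not, for a total of c + b_l + beta c b_l. *)
Lemma lcoef_geometric_factors a (k : nat) :
  lcoef beta a k (g * shifted_factors k) =
  (\prod_(1 <= l < k.+1) (c + b l + beta * c * b l)) * lcoef beta a 0 g.
Proof.
elim: k => [|k IHk]; first by rewrite /shifted_factors !big_geq // mulr1 mul1r.
rewrite big_nat_recr //= [RHS]mulrAC -IHk shifted_factorsS.
set C := (1 + _)%:P; set F := shifted_factors k.
have -> : g * (F * (C + (b k.+1)%:P * 'X)) =
    C * (g * F) + (b k.+1)%:P * (g * F * 'X) by ring.
rewrite lcoefD !lcoefCM lcoefMX lcoef_geometric_step ?size_shifted_factors //.
rewrite (_ : k.+1%:Z - 1 = k); last by lia.
ring.
Qed.
End NilpotentVariable.

(** Reversing the coefficients turns each 1 - x_q u into y - x_q. The size bound is proved in the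
    same induction, because it makes the coefficient just above the top vanish. *)
Lemma coefs_prod_linear {A : comNzRingType} (I : Type) (s : seq I) (x : I -> A) (y : A) :
  (size (\prod_(q <- s) (1 - (x q)%:P * 'X))%R <= (size s).+1)%N /\
  \sum_(r < (size s).+1) y ^+ r * (\prod_(q <- s) (1 - (x q)%:P * 'X))`_(size s - r)
  = \prod_(q <- s) (y - x q).
Proof.
elim: s => [|q s [IHs IHc]].
  by rewrite !big_nil size_poly1 big_ord1 coef1 mulr1.
rewrite !big_cons -IHc; set F := \prod_(_ <- s) _ in IHs IHc *.
set n := size s in IHs IHc *.
have -> : (1 - (x q)%:P * 'X) * F = F - x q *: ('X * F) by rewrite -mul_polyC; ring.
split.
  rewrite (leq_trans (size_polyD _ _)) // geq_max size_polyN /= -/n (leq_trans IHs) //=.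
  rewrite (leq_trans (size_scale_leq _ _)) // (leq_trans (size_polyMleq _ _)) //.
  by rewrite size_polyX.
rewrite /= -/n mulrBl.
rewrite (eq_bigr (fun r : 'I_n.+2 => y ^+ r * F`_(n.+1 - r)
    - x q * (y ^+ r * ('X * F)`_(n.+1 - r)))); last first.
  by move=> r _; rewrite coefB coefZ; ring.
rewrite sumrB -mulr_sumr; congr (_ - _ * _).
  rewrite big_ord_recl subn0 nth_default // mulr0 add0r mulr_sumr.
  by apply: eq_bigr => r _; rewrite /= /bump /= exprS mulrA subSS.
rewrite big_ord_recr /= subnn coefXM mulr0 addr0.
by apply: eq_bigr => r _; rewrite coefXM subSn // -ltnS.
Qed.

(** * The matrix of functionals and its three polynomial bases *)

Section NilpotentVariables.
Variables (A : comNzRingType) (d N : nat) (beta : A) (b : nat -> A) (x : 'I_d -> A).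
Hypothesis x_nil : forall i, x i ^+ N.+1 = 0.

(** The truncated series are exact inverses of the 1 - x_i u, as x_i^(N+1) = 0; the factor 1/(1 +
    beta/u) is left to [lcoef]. *)
Definition genfun k : {poly A} :=
  (\prod_i (1 + beta * x i))%:P * (\prod_i geometric (x i) N) * shifted_factors beta b k.

Definition omit (p : 'I_d) : {poly A} := \prod_(q | q != p) (1 - (x q)%:P * 'X).

Definition vdm_of : A := \prod_(i : 'I_d) \prod_(j : 'I_d | (i < j)%N) (x i - x j).

Let rev_vdm := \prod_(i : 'I_d) \prod_(j : 'I_d | (i < j)%N) (x j - x i).

Lemma genfun_omit k p : genfun k * omit p =
  (\prod_i (1 + beta * x i))%:P * (geometric (x p) N * shifted_factors beta b k).
Proof.
have <- : (\prod_i geometric (x i) N) * omit p = geometric (x p) N.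
  rewrite (bigD1 p) //= -mulrA -big_split big1 ?mulr1 // => i _ /=.
  by rewrite mulrC geometric_inv.
by rewrite /genfun; ring.
Qed.

Lemma omit_seq (p : 'I_d) : exists2 s : seq 'I_d, size s = d.-1 &
  omit p = \prod_(q <- s) (1 - (x q)%:P * 'X) /\
  (forall y, \prod_(q | q != p) (y - x q) = \prod_(q <- s) (y - x q)).
Proof.
exists [seq q <- index_enum 'I_d | q != p].
  rewrite size_filter -sum1_count -[d in RHS]card_ord -(cardC1 p) -sum1_card.
  exact: eq_bigl.
by split=> [|y]; rewrite big_filter.
Qed.

Lemma size_omit p : (size (omit p) <= d)%N.
Proof.
have [s ss [-> _]] := omit_seq p.
by rewrite (leq_trans (coefs_prod_linear s x 0).1) // ss prednK // (leq_trans _ (ltn_ord p)).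
Qed.

Lemma omit_coefs p y :
  \sum_(r < d) y ^+ r * (omit p)`_(rev_ord r) = \prod_(q | q != p) (y - x q).
Proof.
have [s ss [-> ->]] := omit_seq p.
rewrite -(coefs_prod_linear s x y).2 ss; have d_gt0 : (0 < d)%N by case: (p) => i; lia.
rewrite (prednK d_gt0); apply: eq_bigr => r _ /=; congr (_ * _`_ _); lia.
Qed.

(* [rev_vdm], the determinant of the evaluation matrix, stays as a factor on both
   sides: it need not be regular in [A], where the [x i] are nilpotent. *)
Lemma omit_det :
  rev_vdm * \det (\matrix_(r < d, p < d) (omit p)`_(rev_ord r)) = rev_vdm * vdm_of.
Proof.
pose v : 'rV[A]_d := \row_p x p.
have detV : \det (Vandermonde d v)^T = rev_vdm.
  rewrite det_tr det_Vandermonde; apply: eq_bigr => i _; apply: eq_bigr => j _.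
  by rewrite !mxE.
rewrite -[in LHS]detV -det_mulmx.
rewrite (_ : _ *m _ = diag_mx (\row_p \prod_(q | q != p) (x p - x q))); last first.
  apply/matrixP => p p'; rewrite !mxE.
  rewrite (eq_bigr (fun r : 'I_d => x p ^+ r * (omit p')`_(rev_ord r))); last first.
    by move=> r _; rewrite !mxE.
  rewrite omit_coefs; case: (eqVneq p p') => [->|np]; first by rewrite mulr1n.
  by rewrite (bigD1 p) //= subrr mul0r mulr0n.
rewrite det_diag.
(* Splitting each diagonal entry into q < p and q > p separates [rev_vdm] from [vdm_of]. *)
rewrite (eq_bigr (fun p : 'I_d => (\prod_(q : 'I_d | (q < p)%N) (x p - x q)) *
   \prod_(q : 'I_d | (p < q)%N) (x p - x q))); last first.
  move=> p _; rewrite mxE (bigID (fun q : 'I_d => (q < p)%N)) /=; congr (_ * _).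
    by apply: eq_bigl => q; rewrite -val_eqE /=; case: ltngtP.
  by apply: eq_bigl => q; rewrite -val_eqE /=; case: ltngtP.
rewrite big_split /= -/vdm_of; congr (_ * _).
by rewrite /rev_vdm [RHS](exchange_big_dep predT).
Qed.

Variable k : 'I_d -> nat.

(** With 0-based i, the exponent i - d is the i - d - 1 of 1-based rows; it already includes the
    factor 1/(1 + beta/u). *)
Definition functional_mx (P : 'I_d -> {poly A}) : 'M[A]_d :=
  \matrix_(i, j) lcoef beta (i%:Z - d%:Z) (k i) (genfun (k i) * P j).

Definition coefs_mx (P : 'I_d -> {poly A}) : 'M[A]_d :=
  \matrix_(r, j) (P j)`_(rev_ord r).

Definition rev_monomial (j : 'I_d) : {poly A} := 'X^(rev_ord j).

(** By linearity, a row functional on polynomials of degree < d is determined by its values on the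
    monomials. *)
Lemma functional_mxE (P : 'I_d -> {poly A}) : (forall j, (size (P j) <= d)%N) ->
  functional_mx P = functional_mx rev_monomial *m coefs_mx P.
Proof.
move=> sP; apply/matrixP => i j; rewrite !mxE.
have -> : P j = \sum_(r < d) ((P j)`_(rev_ord r))%:P * 'X^(rev_ord r).
  rewrite -[LHS](coefK (P j)) poly_def.
  rewrite (big_ord_widen _ (fun r => (P j)`_r *: 'X^r) (sP j)) big_mkcond.
  rewrite (reindex_inj rev_ord_inj); apply: eq_bigr => r _ /=.
  by rewrite mul_polyC; case: ltnP => // ?; rewrite nth_default // scale0r.
rewrite mulr_sumr lcoef_sum; apply: eq_bigr => r _ /=; rewrite !mxE.
by rewrite mulrCA lcoefCM mulrC.
Qed.

(** The powers of u + beta are monic of the same degrees as those of u, so the change of basis is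
    unitriangular. *)
Lemma det_functional_mx_shift :
  \det (functional_mx (fun j => ('X + beta%:P) ^+ rev_ord j)) =
  \det (functional_mx rev_monomial).
Proof.
have mon n : ('X + beta%:P) ^+ n \is monic by rewrite monic_exp // monicXaddC.
have sz n : size (('X + beta%:P) ^+ n) = n.+1.
  elim: n => [|n IHn]; first by rewrite expr0 size_poly1.
  by rewrite exprS size_monicM ?monicXaddC ?monic_neq0 // IHn size_XaddC.
rewrite functional_mxE => [|j]; last by rewrite sz.
rewrite det_mulmx [X in _ * X]det_trig; last first.
  apply/is_trig_mxP => i j ij; rewrite mxE nth_default // sz.
  by have := ltn_ord j; rewrite /=; lia.
rewrite big1 ?mulr1 // => i _.
by rewrite mxE; have /monicP := mon (rev_ord i); rewrite lead_coefE sz.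
Qed.

Lemma det_functional_mx_omit : \det (functional_mx omit) =
  \det (\matrix_(i < d, p < d) ((\prod_(1 <= l < (k i).+1) (x p + b l + beta * x p * b l))
     * (1 + beta * x p) ^+ i)).
Proof.
set D := \matrix_(i, p) _; set Pi := \prod_i (1 + beta * x i).
pose q p := lcoef beta (- d%:Z) 0 (geometric (x p) N).
have -> : functional_mx omit = D *m diag_mx (\row_p (Pi * q p)).
  apply/matrixP => i p; rewrite mul_mx_diag !mxE genfun_omit lcoefCM -/Pi.
  rewrite lcoef_geometric_factors // addrC lcoef_geometricD // -/(q p).
  ring.
(* Column p carries the scalar [Pi] (1 + beta x_p)^(-d); over the d columns these multiply to [Pi]^d
   [Pi]^(-d) = 1. *)
rewrite det_mulmx det_diag [X in _ * X](_ : _ = 1) ?mulr1 //.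
rewrite (eq_bigr (fun p => Pi * q p)); last by move=> p _; rewrite mxE.
rewrite big_split /= prodr_const card_ord /Pi -prodrXl -big_split big1 //= => p _.
exact: lcoef_geometricN.
Qed.

Lemma bialternant_functional :
  \det (functional_mx rev_monomial) * vdm_of * rev_vdm =
  \det (\matrix_(i < d, p < d) ((\prod_(1 <= l < (k i).+1) (x p + b l + beta * x p * b l))
     * (1 + beta * x p) ^+ i)) * rev_vdm.
Proof.
rewrite -det_functional_mx_omit (functional_mxE size_omit) det_mulmx.
by rewrite -mulrA [vdm_of * _]mulrC -omit_det; ring.
Qed.
End NilpotentVariables.

(** * The determinant for a one-row partition *)

Section OneRow.
Variables (A : comNzRingType) (d N : nat) (beta : A) (b : nat -> A) (x : 'I_d -> A).
Hypotheses (x_nil : forall i, x i ^+ N.+1 = 0) (d_gt0 : (0 < d)%N).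

(** At u = -beta each factor in b becomes 1, and each geometric series inverts the matching 1 + beta
    x_i. *)
Lemma genfun_horner k : (genfun N beta b x k).[- beta] = 1.
Proof.
rewrite /genfun /shifted_factors !hornerM !horner_prod hornerC.
rewrite [X in _ * X]big1 ?mulr1 => [|l _]; last by rewrite !hornerE addNr mul0r addr0.
rewrite -big_split big1 //= => i _.
have /(congr1 (fun p => p.[- beta])) := geometric_inv (x_nil i).
by rewrite hornerM !hornerE mulrN opprK [x i * _]mulrC.
Qed.

(** In the basis of powers of u + beta the matrix is upper triangular, and its diagonal entries
    below the first row are 1. *)
Lemma det_functional_mx_row (m : nat) (k : 'I_d -> nat) :
  (forall i : 'I_d, k i = (if i == 0%N :> nat then m else 0%N) + (d - i.+1))%N ->
  \det (functional_mx N beta b x k (fun j => ('X + beta%:P) ^+ rev_ord j)) =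
  lcoef beta (-1) m (genfun N beta b x (m + d - 1)).
Proof.
move=> kE; rewrite -det_tr det_trig; last first.
  apply/is_trig_mxP => j i ji; rewrite !mxE.
  (* The power d - i cancels the exponent i - d. What remains is the coefficient of u^(-1) in a
     polynomial, which is 0. *)
  have -> : rev_ord j = (i - j.+1 + (d - i))%N :> nat.
    by have := ltn_ord i; rewrite /=; lia.
  rewrite exprD mulrA lcoefMXDn.
  have -> : i%:Z - d%:Z + (d - i)%N%:Z = 0 by have := ltn_ord i; lia.
  by rewrite lcoef0 kE (_ : _ - _ = Negz 0) //; case: eqP; have := ltn_ord i; lia.
rewrite (bigD1 (Ordinal d_gt0)) //= big1 ?mulr1 => [|i i0]; rewrite !mxE lcoefMXDn.
  by rewrite kE /=; congr lcoef; [lia | lia | congr genfun; lia].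
have {}i0 : i != 0%N :> nat by apply: contra i0 => /eqP i0; exact/eqP/val_inj.
(* On the diagonal the exponent becomes -1 and the degree 0, so the entry is the value of the
   generating function at -beta. *)
rewrite kE (negbTE i0) -[RHS](genfun_horner (d - i.+1)) -lcoefN1_horner add0n.
by congr lcoef; have := ltn_ord i; rewrite /=; lia.
Qed.
End OneRow.

(** * Compatibility with ring morphisms *)

Section Morphisms.
Variables (A A' : comNzRingType) (f : {rmorphism A -> A'}) (beta : A).

Lemma rmorph_binw a z : f (binw beta a z) = binw (f beta) a z.
Proof.
case: z => s; last exact: rmorph0.
by rewrite /binw rmorphM rmorph_int rmorphXn.
Qed.

Lemma rmorph_lcoef a m (F : {poly A}) :
  f (lcoef beta a m F) = lcoef (f beta) a m (map_poly f F).
Proof.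
rewrite (@lcoef_widen _ _ _ _ (map_poly f F) (size F)) ?size_poly // rmorph_sum.
by apply: eq_bigr => n _ /=; rewrite rmorphM /= rmorph_binw coef_map.
Qed.

Lemma map_geometric (c : A) N : map_poly f (geometric c N) = geometric (f c) N.
Proof.
rewrite /geometric rmorph_sum; apply: eq_bigr => e _ /=.
by rewrite rmorphM /= map_polyC map_polyXn /= rmorphXn.
Qed.

Lemma map_genfun d N (b : nat -> A) (x : 'I_d -> A) k :
  map_poly f (genfun N beta b x k) = genfun N (f beta) (f \o b) (f \o x) k.
Proof.
rewrite /genfun /shifted_factors !rmorphM /= map_polyC /= !rmorph_prod /=.
congr (_ * _ * _).
- by apply: eq_bigr => i _; rewrite (rmorphD f) rmorph1 rmorphM.
- by apply: eq_bigr => i _; rewrite map_geometric.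
- apply: eq_bigr => l _.
  by rewrite rmorphD rmorph1 rmorphM rmorphD /= map_polyX !map_polyC.
Qed.

Lemma map_functional_mx d N (b : nat -> A) (x : 'I_d -> A) k (P : 'I_d -> {poly A}) :
  map_mx f (functional_mx N beta b x k P) =
  functional_mx N (f beta) (f \o b) (f \o x) k (map_poly f \o P).
Proof.
by apply/matrixP => i j; rewrite !mxE rmorph_lcoef rmorphM /= map_genfun.
Qed.
End Morphisms.

Lemma geometric_nil {A : nzRingType} (c : A) M N :
  c ^+ M.+1 = 0 -> (M <= N)%N -> geometric c N = geometric c M.
Proof.
move=> cM MN; apply/polyP => i; rewrite !coef_geometric.
have [iM|Mi] := leqP i M; first by rewrite (leq_trans iM MN).
by rewrite -(subnK Mi) exprD cM mulr0 if_same.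
Qed.

Lemma genfun_nil {A : comNzRingType} d (beta : A) b (x : 'I_d -> A) k M N :
  (forall i, x i ^+ M.+1 = 0) -> (M <= N)%N ->
  genfun N beta b x k = genfun M beta b x k.
Proof.
move=> xM MN; rewrite /genfun; congr (_ * _ * _).
by apply: eq_bigr => i _; rewrite (geometric_nil (xM i) MN).
Qed.

(** * Polynomials modulo monomials of degree > N *)

Section Truncation.
Variables (R : comNzRingType) (d N : nat).
Implicit Types (p q : {mpoly R[d]}) (m g : 'X_{1..d}).

Definition high_order : {pred {mpoly R[d]}} :=
  fun p => all (fun m : 'X_{1..d} => N < mdeg m)%N (msupp p).

Lemma high_orderP p :
  reflect (forall m, (mdeg m <= N)%N -> p@_m = 0) (p \in high_order).
Proof.
apply: (iffP allP) => [h m mN|h m].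
  by apply: memN_msupp_eq0; apply: contraTN mN => /h; rewrite ltnNge.
by rewrite mcoeff_msupp ltnNge; apply: contra => /h ->.
Qed.

Fact high_order_idealr : idealr_closed high_order.
Proof.
split.
- by apply/high_orderP => m _; rewrite mcoeff0.
- apply/negP => /high_orderP /(_ 0%MM); rewrite mdeg0 mcoeff1 eqxx => /(_ isT) /eqP.
  by rewrite oner_eq0.
move=> a u v /high_orderP hu /high_orderP hv; apply/high_orderP => m mN.
rewrite mcoeffD (hv _ mN) addr0 mcoeffM big1 // => -[k1 k2] /= /eqP mE.
have := congr1 (@mdeg d) mE; rewrite mdegD => dm.
by rewrite hu ?mulr0 //; lia.
Qed.

HB.instance Definition _ := isIdealr.Build _ high_order high_order_idealr.

Definition trunc_ring : comNzRingType := {ideal_quot high_order}.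

Definition trunc_pi : {rmorphism {mpoly R[d]} -> trunc_ring} :=
  (\pi_({ideal_quot high_order}))%qT.

Lemma trunc_piP p q :
  trunc_pi p = trunc_pi q <-> (forall m, (mdeg m <= N)%N -> p@_m = q@_m).
Proof.
split=> [/eqP|h].
  rewrite -Quotient.idealrBE => /high_orderP h m /h /eqP.
  by rewrite mcoeffB subr_eq0 => /eqP.
apply/eqP; rewrite -Quotient.idealrBE; apply/high_orderP => m /h.
by rewrite mcoeffB => ->; rewrite subrr.
Qed.

Lemma trunc_piX_nil i : trunc_pi 'X_i ^+ N.+1 = 0.
Proof.
rewrite -rmorphXn -(rmorph0 trunc_pi); apply/trunc_piP => m mN.
rewrite mcoeffXn mcoeff0; case: eqP => // mE; move: mN.
by rewrite -mE mdegMn mdeg1 mul1n ltnn.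
Qed.
End Truncation.

(** * From coefficient functions of power series to the functional *)

Section Coefficients.
Variables (R : comNzRingType) (d : nat) (beta : R) (b : nat -> R).
Implicit Types (p q : {mpoly R[d]}) (m g : 'X_{1..d}) (F : {poly {mpoly R[d]}}).

Definition mgenfun N k : {poly {mpoly R[d]}} :=
  genfun N beta%:MP (fun l => (b l)%:MP) (fun i => 'X_i) k.

Lemma BpolyE N k : Bpoly d beta b N k = mgenfun N k.
Proof.
rewrite /Bpoly (eq_bigr (fun i : 'I_d => 1 + beta%:MP * 'X_i)) // => i _.
by rewrite mul_mpolyC.
Qed.

(** Modulo degree > deg g, each x_i is nilpotent of order deg g + 1, so longer geometric series
    agree with the short one. *)
Lemma coef_mgenfun_trunc N k n g : (mdeg g <= N)%N ->
  ((mgenfun N k)`_n)@_g = ((mgenfun (mdeg g) k)`_n)@_g.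
Proof.
move=> gN; move: g gN (leqnn (mdeg g)) => g gN.
have /trunc_piP : trunc_pi R d (mdeg g) (mgenfun N k)`_n =
    trunc_pi R d (mdeg g) (mgenfun (mdeg g) k)`_n; last exact.
rewrite -!coef_map /= !map_genfun (genfun_nil _ _ _ _ gN) // => i.
exact: trunc_piX_nil.
Qed.

Definition graded c F := forall n g, (mdeg g + c < n)%N -> (F`_n)@_g = 0.

Lemma gradedM c c' F F' : graded c F -> graded c' F' -> graded (c + c') (F * F').
Proof.
move=> hF hF' n g gn; rewrite coefM raddf_sum big1 // => i _ /=.
rewrite mcoeffM big1 // => -[k1 k2] /= /eqP gE.
have := congr1 (@mdeg d) gE; rewrite mdegD => dg.
have [ki|ik] := ltnP (mdeg k1 + c) i; first by rewrite hF ?mul0r.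
by rewrite hF' ?mulr0 //; lia.
Qed.

Lemma gradedC p : graded 0 p%:P.
Proof. by move=> [|n] g //; rewrite coefC mcoeff0. Qed.

(** In the geometric series every u comes with some x_i; only the k factors in b supply a u without
    one. *)
Lemma graded_mgenfun N k : graded k (mgenfun N k).
Proof.
rewrite -[k in graded k]add0n; apply: gradedM; last first.
  move=> n g gn; rewrite nth_default ?mcoeff0 //.
  by rewrite (leq_trans (size_shifted_factors _ _ _)) //; lia.
rewrite -[0%N]addn0; apply: gradedM; first exact: gradedC.
elim/big_ind: _ => [|F F' hF hF'|i _]; first exact: gradedC.
  by rewrite -[0%N]addn0; exact: gradedM.
move=> n g; rewrite addn0 coef_geometric => gn; case: ifP => _; last exact: mcoeff0.
rewrite mcoeffXn; case: eqP => // gE; move: gn.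
by rewrite -gE mdegMn mdeg1 mul1n ltnn.
Qed.

Lemma sum_shift (c f : nat -> R) (H K : nat) (m : int) :
  (forall n, (H <= n)%N -> f n = 0) -> H%:Z <= K%:Z + m ->
  \sum_(s < K) c s * (if 0 <= m + s%:Z then f (absz (m + s%:Z)) else 0) =
  \sum_(n < H) f n * (if n%:Z - m is Posz s then c s else 0).
Proof.
move=> fH HK.
(* The substitution n = m + s is not a bijection of the two ranges, as m may have either sign, so it
   goes through a double sum with an indicator. *)
transitivity (\sum_(s < K) \sum_(n < H) c s * (f n * (n%:Z == m + s%:Z)%:R)).
  apply: eq_bigr => s _; rewrite -mulr_sumr; congr (_ * _).
  case: ifP => ms; last first.
    rewrite big1 // => n _; case: eqP => [nE|_]; last by rewrite mulr0.
    by move: ms; rewrite -nE.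
  have [nH|Hn] := ltnP (absz (m + s%:Z)) H.
    rewrite (bigD1 (Ordinal nH)) //= gez0_abs // eqxx mulr1 big1 ?addr0 // => n nE.
    case: eqP => [e|_]; last by rewrite mulr0.
    by move: nE; rewrite -val_eqE /= -e absz_nat eqxx.
  rewrite fH // big1 // => n _; case: eqP => [e|_]; last by rewrite mulr0.
  by move: Hn; rewrite -e absz_nat leqNgt ltn_ord.
rewrite exchange_big; apply: eq_bigr => n _ /=.
rewrite (eq_bigr (fun s : 'I_K => f n * (c s * (n%:Z == m + s%:Z)%:R))); last first.
  by move=> s _; rewrite mulrCA.
rewrite -mulr_sumr; congr (_ * _).
case E : (n%:Z - m) => [t|t].
  have tK : (t < K)%N by have := ltn_ord n; lia.
  rewrite (bigD1 (Ordinal tK)) //= big1 ?addr0 => [|s sE].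
    by have /eqP -> : n%:Z = m + t%:Z by [lia]; rewrite mulr1.
  have /negbTE -> : n%:Z != m + s%:Z; last by rewrite mulr0.
  by apply: contra sE => /eqP e; apply/eqP/val_inj => /=; lia.
by rewrite big1 // => s _; have /negbTE -> : n%:Z != m + s%:Z by [lia]; rewrite mulr0.
Qed.

Lemma GkE k (m : int) g : Gk beta b k m g = 
  \sum_(n < mdeg g + k + 1) ((mgenfun (mdeg g) k)`_n)@_g * binw beta (-1) (n%:Z - m).
Proof.
rewrite /Gk /Bcoef BpolyE.
rewrite (@sum_shift _ (fun n => ((mgenfun (mdeg g) k)`_n)@_g) (mdeg g + k + 1)).
- apply: eq_bigr => n _; congr (_ * _).
  by case: (n%:Z - m) => // s; rewrite binwN1.
- by move=> n nH; apply: graded_mgenfun; lia.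
- lia.
Qed.

Lemma mcoeff_lcoef N a k (m : int) g : (mdeg g <= N)%N ->
  (lcoef beta%:MP a m (mgenfun N k))@_g =
  \sum_(n < mdeg g + k + 1) ((mgenfun (mdeg g) k)`_n)@_g * binw beta a (n%:Z - m).
Proof.
move=> gN; set H := (_ + 1)%N.
rewrite (@lcoef_widen _ _ _ _ _ (maxn H (size (mgenfun N k)))) ?leq_maxr //.
rewrite raddf_sum (big_ord_widen _ 
  (fun n => ((mgenfun (mdeg g) k)`_n)@_g * binw beta a (n%:Z - m))
  (leq_maxl H (size (mgenfun N k)))).
rewrite [RHS]big_mkcond; apply: eq_bigr => n _ /=.
rewrite -(rmorph_binw (mpolyC d (R := R))) mulrC mcoeffCM mulrC coef_mgenfun_trunc //.
by case: ltnP => // Hn; rewrite graded_mgenfun ?mul0r //; lia.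
Qed.

Lemma Gk_lcoef N k (m : int) g : (mdeg g <= N)%N ->
  Gk beta b k m g = (lcoef beta%:MP (-1) m (mgenfun N k))@_g.
Proof. by move=> gN; rewrite GkE mcoeff_lcoef. Qed.

Lemma ent_lcoef N a k (m : int) g : (mdeg g <= N)%N ->
  ent beta b a k m g = (lcoef beta%:MP (a - 1) m (mgenfun N k))@_g.
Proof.
move=> gN; rewrite mcoeff_lcoef // /ent.
under eq_bigr => s _ do rewrite GkE mulr_sumr.
rewrite exchange_big; apply: eq_bigr => n _ /=.
rewrite -(@binw_conv _ _ _ _ (mdeg g + k + `|m|%N + 1)); last by have := ltn_ord n; lia.
rewrite mulr_sumr; apply: eq_bigr => s _.
by rewrite mulrCA; congr (_ * (_ * binw _ _ _)); lia.
Qed.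

(** A coefficient of degree at most N of a determinant depends only on the entries modulo degree >
    N, so polynomial representatives suffice. *)
Lemma ps_det_poly N (M : 'I_d -> 'I_d -> ps R d) (P : 'M[{mpoly R[d]}]_d) :
  (forall i j g, (mdeg g <= N)%N -> M i j g = (P i j)@_g) ->
  forall g, (mdeg g <= N)%N -> ps_det M g = (\det P)@_g.
Proof.
move=> MP g gN; rewrite /ps_det; set T := \matrix_(_, _) _.
have /trunc_piP : trunc_pi R d (mdeg g) (\det T) = trunc_pi R d (mdeg g) (\det P);
  last exact.
rewrite -!det_map_mx; congr (\det _); apply/matrixP => i j; rewrite !mxE.
by apply/trunc_piP => m mg; rewrite mcoeff_mpoly // MP // (leq_trans mg gN).
Qed.
End Coefficients.

(** * Cancelling factors with a controlled loss of precision *)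

Section Cancellation.
Variables (R : comNzRingType) (d : nat).
Implicit Types (p v : {mpoly R[d]}).

(** A factor may be a zero divisor in a truncated ring. Cancelling it is still possible when the
    precision drops by an [l] independent of [N] and [p]. *)
Definition cancellable v := exists l, forall N p,
  p * v \in high_order (N + l) -> p \in high_order N.

Lemma cancellable1 : cancellable 1.
Proof. by exists 0%N => N p; rewrite mulr1 addn0. Qed.

Lemma cancellableM v w : cancellable v -> cancellable w -> cancellable (v * w).
Proof.
move=> [l hl] [l' hl']; exists (l + l')%N => N p.
by rewrite mulrA addnA => /hl' /hl.
Qed.

Lemma mcoeff_MXU p (i : 'I_d) m :
  (p * 'X_i)@_m = if (0 < m i)%N then p@_(m - U_(i)) else 0.
Proof.
case: ifP => mi.
  have lei : (U_(i) <= m)%MM.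
    by apply/mnm_lepP => j; rewrite mnm1E; case: eqP => // <-.
  by rewrite -[in LHS](submK lei) addmC mcoeffMX.
rewrite mcoeffM big1 // => -[k1 k2] /= /eqP mE.
rewrite mcoeffX; case: eqP => [e|_]; last by rewrite mulr0.
by have := congr1 (fun m' : 'X_{1..d} => m' i) mE; rewrite -e mnmDE mnm1E eqxx; lia.
Qed.

(* The relation between the coefficients of [p] moves exponents from [j] to [i];
   after [m j] steps one compares with a coefficient without [X_j]. *)
Lemma cancellable_sub i j : i != j -> cancellable ('X_i - 'X_j).
Proof.
move=> ij; exists 1%N => N p /high_orderP h; apply/high_orderP => m.
have step m' : (mdeg m' <= N)%N ->
    p@_m' = if (0 < m' j)%N then p@_(m' + U_(i) - U_(j)) else 0.
  move=> m'N; have := h (m' + U_(i))%MM.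
  rewrite mdegD mdeg1 leq_add2r => /(_ m'N).
  rewrite mulrBr mcoeffB (addmC m') mcoeffMX -(addmC m') mcoeff_MXU.
  rewrite mnmDE mnm1E (negbTE ij) addn0.
  by move/eqP; rewrite subr_eq0 => /eqP.
have [t] := ubnP (m j); elim: t m => // t IHt m; rewrite ltnS => mt mN.
rewrite step //; case: ifP => // mj; apply: IHt.
  by rewrite mnmBE mnmDE !mnm1E eqxx (negbTE ij); lia.
have lej : (U_(j) <= m + U_(i))%MM.
  apply/mnm_lepP => l; rewrite mnmDE mnm1E; case: eqP => // <-; lia.
by have := congr1 (@mdeg _) (submK lej); rewrite !mdegD !mdeg1; lia.
Qed.

Lemma cancellable_prod (I : Type) (s : seq I) (P : pred I) (F : I -> {mpoly R[d]}) :
  (forall i, P i -> cancellable (F i)) -> cancellable (\prod_(i <- s | P i) F i).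
Proof.
move=> hF; elim/big_ind: _ => //; first exact: cancellable1.
exact: cancellableM.
Qed.
End Cancellation.

(** * Comparison of the bi-alternant with both determinants *)

Section Assembly.
Variables (R : comNzRingType) (d : nat) (beta : R) (b : nat -> R).
Implicit Types (lam : 'I_d -> nat) (g : 'X_{1..d}).

Definition degrees lam (i : 'I_d) : nat := lam i + (d - i.+1).

Definition jacobi_trudi N lam (P : 'I_d -> {poly {mpoly R[d]}}) : 'M[{mpoly R[d]}]_d :=
  functional_mx N beta%:MP (fun l => (b l)%:MP) (fun i => 'X_i) (degrees lam) P.

Definition rev_shifted (j : 'I_d) : {poly {mpoly R[d]}} :=
  ('X + (beta%:MP)%:P) ^+ rev_ord j.

Lemma M1_lcoef N lam i j g : (mdeg g <= N)%N ->
  M1 beta b lam i j g = (jacobi_trudi N lam (@rev_monomial _ d) i j)@_g.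
Proof.
move=> gN; rewrite /M1 (ent_lcoef _ _ _ _ _ gN) mxE lcoefMXn; congr (_@__).
have [id jd] := (ltn_ord i, ltn_ord j).
by rewrite /mgenfun /degrees; congr lcoef; rewrite /=; lia.
Qed.

(** Absorbing (u + beta)^(d-1-j) turns the exponent i - d into i - j - 1, which is the binomial's i
    - j lowered by 1/(1 + beta/u). *)
Lemma M2_lcoef N lam i j g : (mdeg g <= N)%N ->
  M2 beta b lam i j g = (jacobi_trudi N lam rev_shifted i j)@_g.
Proof.
move=> gN; rewrite /M2 (ent_lcoef _ _ _ _ _ gN) mxE lcoefMXDn; congr (_@__).
have [id jd] := (ltn_ord i, ltn_ord j).
by rewrite /mgenfun /degrees; congr lcoef; rewrite /=; lia.
Qed.

Lemma trunc_pi_bialt N lam : trunc_pi R d N (bialt beta b lam) =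
  \det (\matrix_(i < d, p < d)
    ((\prod_(1 <= l < (degrees lam i).+1)
        (trunc_pi R d N 'X_p + trunc_pi R d N (b l)%:MP
          + trunc_pi R d N beta%:MP * trunc_pi R d N 'X_p * trunc_pi R d N (b l)%:MP))
     * (1 + trunc_pi R d N beta%:MP * trunc_pi R d N 'X_p) ^+ i)).
Proof.
rewrite /bialt -det_map_mx; congr (\det _); apply/matrixP => i p; rewrite !mxE.
rewrite rmorphM rmorphXn rmorphD rmorph1 rmorphM /fpow rmorph_prod /=.
by congr (_ * _); apply: eq_bigr => l _; rewrite /oplus !rmorphD !rmorphM.
Qed.

Lemma bialternant_trunc N lam (G : {mpoly R[d]}) : G * vdm R d = bialt beta b lam ->
  let v := \prod_(i : 'I_d) \prod_(j : 'I_d | (i < j)%N) ('X_j - 'X_i) in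
  trunc_pi R d N (\det (jacobi_trudi N lam (@rev_monomial _ d)) * (vdm R d * v)) =
  trunc_pi R d N (G * (vdm R d * v)).
Proof.
move=> GE v; rewrite !mulrA GE !rmorphM /= trunc_pi_bialt -det_map_mx.
set pi := trunc_pi R d N.
have := bialternant_functional (pi beta%:MP) (fun l => pi (b l)%:MP)
  (@trunc_piX_nil R d N) (degrees lam).
rewrite /jacobi_trudi map_functional_mx -/pi.
have -> : vdm_of (fun i => pi 'X_i) = pi (vdm R d).
  rewrite /vdm rmorph_prod; apply: eq_bigr => i _; rewrite rmorph_prod.
  by apply: eq_bigr => j _; rewrite rmorphB.
have -> : \prod_(i : 'I_d) \prod_(j : 'I_d | (i < j)%N) (pi 'X_j - pi 'X_i) = pi v.
  rewrite /v rmorph_prod; apply: eq_bigr => i _; rewrite rmorph_prod.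
  by apply: eq_bigr => j _; rewrite rmorphB.
move=> <-; congr (\det _ * _ * _); apply/matrixP => i j; rewrite !mxE.
by rewrite /= /rev_monomial map_polyXn.
Qed.

Lemma cancellable_vdm : cancellable
  (vdm R d * \prod_(i : 'I_d) \prod_(j : 'I_d | (i < j)%N) ('X_j - 'X_i)).
Proof.
apply: cancellableM; apply: cancellable_prod => i _;
  apply: cancellable_prod => j ij; apply: cancellable_sub;
  by apply: contraTneq ij => ->; rewrite ltnn.
Qed.

Lemma ps_of_poly_jacobi_trudi lam (G : {mpoly R[d]}) (M : 'I_d -> 'I_d -> ps R d) P :
  G * vdm R d = bialt beta b lam ->
  (forall N i j g, (mdeg g <= N)%N -> M i j g = (jacobi_trudi N lam P i j)@_g) ->
  (forall N, \det (jacobi_trudi N lam P) = \det (jacobi_trudi N lam (@rev_monomial _ d))) ->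
  ps_of_poly G =1 ps_det M.
Proof.
move=> GE MP detP g; have [l cancel_vdm] := cancellable_vdm.
(* The [l] extra degrees are those lost when both Vandermonde products are cancelled. *)
set N := (mdeg g + l)%N; have gN : (mdeg g <= N)%N by exact: leq_addr.
rewrite (ps_det_poly (MP N) gN) detP /ps_of_poly; apply/esym.
apply: ((trunc_piP _ _ _).1 _ g (leqnn _)); apply/eqP.
rewrite -subr_eq0 -rmorphB -(rmorph0 (trunc_pi R d (mdeg g))); apply/eqP/trunc_piP.
move=> m mg; rewrite mcoeff0; move: m mg; apply/high_orderP; apply: cancel_vdm.
rewrite mulrBl; apply/high_orderP => m mN; rewrite mcoeffB.
by rewrite ((trunc_piP _ _ _).1 (bialternant_trunc N GE) m mN) subrr.
Qed.

Lemma ps_of_poly_M1 lam G : G * vdm R d = bialt beta b lam ->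
  ps_of_poly G =1 ps_det (M1 beta b lam).
Proof. by move=> /ps_of_poly_jacobi_trudi; apply=> // N i j g; exact: M1_lcoef. Qed.

Lemma ps_of_poly_M2 lam G : G * vdm R d = bialt beta b lam ->
  ps_of_poly G =1 ps_det (M2 beta b lam).
Proof.
move=> /ps_of_poly_jacobi_trudi; apply=> [N i j g|N]; first exact: M2_lcoef.
exact: det_functional_mx_shift.
Qed.

Lemma ps_det_M2_row (k : nat) g : (0 < d)%N ->
  ps_det (M2 beta b (@row_part d k)) g = Gk beta b (k + d - 1) k g.
Proof.
move=> d_gt0; have le_g := leqnn (mdeg g).
rewrite (ps_det_poly (@M2_lcoef (mdeg g) _) le_g) (Gk_lcoef _ _ _ _ le_g).
apply: ((trunc_piP _ _ _).1 _ g le_g).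
rewrite -det_map_mx map_functional_mx rmorph_lcoef map_genfun.
rewrite -(det_functional_mx_row _ _ _ d_gt0 (k := degrees (@row_part d k))) //.
  congr (\det _); apply/matrixP => i j; rewrite !mxE; congr (lcoef _ _ _ (_ * _)).
  by rewrite /= /rev_shifted rmorphXn rmorphD /= map_polyX map_polyC.
exact: trunc_piX_nil.
Qed.
End Assembly.

Unset Implicit Arguments.

(* G_lambda(x|b) is the polynomial G with G * vdm = bialt lam
   (the bi-alternant quotient). *)
Theorem theorem1p1 (R : comNzRingType) (d : nat) (beta : R) (b : nat -> R) :
  (0 < d)%N ->
  (forall lam : 'I_d -> nat,
     (forall i j : 'I_d, (i <= j)%N -> (lam j <= lam i)%N) ->
     forall G : {mpoly R[d]}, G * vdm R d = bialt beta b lam ->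
       ps_of_poly G =1 ps_det (M1 beta b lam) /\
       ps_of_poly G =1 ps_det (M2 beta b lam))
  /\
  (forall (k : nat) (G : {mpoly R[d]}),
     G * vdm R d = bialt beta b (@row_part d k) ->
     ps_of_poly G =1 Gk beta b (k + d - 1) k).
Proof.
move=> d_gt0; split=> [lam _ G GE|k G GE g].
  by split; [exact: ps_of_poly_M1 | exact: ps_of_poly_M2].
by rewrite (ps_of_poly_M2 GE) ps_det_M2_row.
Qed.
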